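(* For the problem $P2,S1|s_j,t_j|C_{max}$, the minimization of the makespan is equivalent to the minimization of the total idle time of the machines: for every instance, a feasible schedule minimizes the makespan $C_{max}$ among all feasible schedules if and only if it minimizes the total idle time $\widehat{IT}$ among all feasible schedules.
   Context: Problem $P2,S1|s_j,t_j|C_{max}$: there are $n$ independent jobs $J_1,\dots,J_n$, all available at time $0$, each with loading time $s_j>0$, integer processing time $p_j>0$ and unloading time $t_j>0$; two identical parallel machines $M=\{1,2\}$; and one server. Each job is assigned to one machine, where it is loaded by the server, then processed, then unloaded by the server, with no delay between loading and processing nor between processing and unloading. A machine handles at most one job at a time and is occupied throughout loading, processing and unloading; the server performs at most one loading or unloading operation at a time. No preemption. The makespan $C_{max}$ is the largest completion time (end of unloading) of a job. For a feasible schedule, $IT_k$ denotes the total idle time on machine $k$, i.e. the total amount of time in $[0,C_{max}]$ (with $C_{max}$ the makespan of that schedule) during which machine $k$ is not occupied by a job (including the time after machine $k$ has completed all of its jobs and before the other machine completes its own). $\widehat{IT}=\sum_{k\in M}IT_k$. *)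

(* Defs.v *)
From mathcomp Require Import all_boot all_order all_algebra.
From mathcomp Require Import all_classical all_reals all_analysis.

Set Implicit Arguments.
Unset Strict Implicit.
Unset Printing Implicit Defensive.

Import Order.TTheory GRing.Theory Num.Theory.
Import numFieldNormedType.Exports.

Local Open Scope classical_set_scope.
Local Open Scope ring_scope.

Record instance (R : realType) (n : nat) := Instance {
  loading : 'I_n -> R;
  processing : 'I_n -> nat;
  unloading : 'I_n -> R;
  loading_gt0 : forall j, 0 < loading j;
  processing_gt0 : forall j, (0 < processing j)%N;
  unloading_gt0 : forall j, 0 < unloading j
}.

(* As no delay is allowed between loading, processing and unloading, a schedule
   is determined by the machine and the loading start time of every job. *)
Record schedule (R : realType) (n : nat) := Schedule {
  machine : 'I_n -> 'I_2;
  start : 'I_n -> R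
}.

Section Scheduling.
Context {R : realType} {n : nat}.
Variables (I : instance R n) (S : schedule R n).

Definition processing_start (j : 'I_n) : R := start S j + loading I j.

Definition unloading_start (j : 'I_n) : R :=
  processing_start j + (processing I j)%:R.

Definition completion (j : 'I_n) : R := unloading_start j + unloading I j.

(* Time intervals are half-open, so that an operation may begin at the very
   instant at which the preceding one ends. *)
Definition occupation (j : 'I_n) : set R := `[start S j, completion j[%classic.

(* The pair (j, false) stands for the loading of job j, and (j, true) for its
   unloading. *)
Definition server_operation (o : 'I_n * bool) : set R :=
  if o.2 then `[unloading_start o.1, completion o.1[%classic
  else `[start S o.1, processing_start o.1[%classic.

Definition feasible : Prop :=
  [/\ forall j, 0 <= start S j,
      forall i j, i != j -> machine S i = machine S j ->
        occupation i `&` occupation j = set0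
    & forall o1 o2, o1 != o2 ->
        server_operation o1 `&` server_operation o2 = set0].

(* Completion times of feasible schedules are positive; the default value 0 is
   only reached when there is no job. *)
Definition makespan : R := \big[Num.max/0]_(j < n) completion j.

Definition idle_set (k : 'I_2) : set R :=
  [set x | 0 <= x <= makespan /\
           forall j, machine S j = k -> ~ occupation j x].

Definition idle_time (k : 'I_2) : \bar R := lebesgue_measure (idle_set k).

Definition total_idle_time : \bar R := (\sum_(k < 2) idle_time k)%E.

End Scheduling.

Definition minimizes (T : Type) (d : Order.disp_t) (V : porderType d)
    (P : T -> Prop) (f : T -> V) (x : T) : Prop :=
  P x /\ forall y, P y -> (f x <= f y)%O.

(* Main.v *)
Require Import Defs.
From mathcomp Require Import all_boot all_order all_algebra.
From mathcomp Require Import all_classical all_reals all_analysis.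

(** Every feasible schedule keeps the two machines busy for the same total
    amount of time, namely the sum [workload] of the durations of all jobs: the
    occupation intervals of the jobs of a machine are pairwise disjoint and lie
    between time 0 and the makespan. On each machine, idle time and busy time
    add up to the makespan ([idle_time_add_busy]), so the total idle time is
    twice the makespan minus a constant of the instance
    ([total_idle_timeE]). The two objectives are thus related by an increasing
    affine map, and have the same minimizers. *)

Set Implicit Arguments.
Unset Strict Implicit.
Unset Printing Implicit Defensive.

Import Order.TTheory GRing.Theory Num.Theory.

Local Open Scope classical_set_scope.
Local Open Scope ring_scope.

Definition duration (R : realType) (n : nat) (I : instance R n) (j : 'I_n) : R :=
  loading I j + (processing I j)%:R + unloading I j.

Definition workload (R : realType) (n : nat) (I : instance R n) : R :=
  \sum_(j < n) duration I j.

Lemma completionE (R : realType) (n : nat) (I : instance R n)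
    (S : schedule R n) (j : 'I_n) :
  completion I S j = start S j + duration I j.
Proof. by rewrite /completion /unloading_start /processing_start !addrA. Qed.

Lemma duration_ge0 (R : realType) (n : nat) (I : instance R n) (j : 'I_n) :
  0 <= duration I j.
Proof.
by rewrite !addr_ge0 ?ler0n ?(ltW (loading_gt0 _ _)) ?(ltW (unloading_gt0 _ _)).
Qed.

Lemma completion_le_makespan (R : realType) (n : nat) (I : instance R n)
    (S : schedule R n) (j : 'I_n) : completion I S j <= makespan I S.
Proof. exact: le_bigmax. Qed.

Lemma makespan_ge0 (R : realType) (n : nat) (I : instance R n)
    (S : schedule R n) : 0 <= makespan I S.
Proof. exact: bigmax_ge_id. Qed.

Lemma measure_occupation (R : realType) (n : nat) (I : instance R n)
    (S : schedule R n) (j : 'I_n) :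
  lebesgue_measure (occupation I S j) = (duration I j)%:E.
Proof.
rewrite lebesgue_measure_itv /= lte_fin completionE ltrDl.
rewrite -EFinD addrAC subrr add0r.
by have := duration_ge0 I j; rewrite le_eqVlt => /predU1P[<-|->//]; rewrite ltxx.
Qed.

(** The idle set is what the occupation intervals leave of the closed interval
    from 0 to the makespan; feasibility makes these intervals disjoint and puts
    them inside it, so the measures add up. *)
Lemma idle_time_add_busy (R : realType) (n : nat) (I : instance R n)
    (S : schedule R n) (k : 'I_2) :
  feasible I S ->
  (idle_time I S k + (\sum_(j < n | machine S j == k) duration I j)%:E =
   (makespan I S)%:E)%E.
Proof.
move=> [start_ge0 disj _].
pose busy := \big[setU/set0]_(j < n | machine S j == k) occupation I S j.
have mbusy : measurable busy.
  by apply: bigsetU_measurable => j _; exact: measurable_itv.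
have busy_sub : busy `<=` `[0, makespan I S].
  rewrite /busy; apply: (big_ind (fun A => A `<=` `[0, makespan I S])).
  - exact: sub0set.
  - by move=> A B AS BS; rewrite subUset.
  - move=> j _ x /=; rewrite !in_itv /= => /andP[sx xc]; apply/andP; split.
      exact: le_trans (start_ge0 j) sx.
    exact: le_trans (ltW xc) (completion_le_makespan I S j).
have idleE : idle_set I S k = `[0, makespan I S] `\` busy.
  rewrite /busy -bigcup_seq_cond.
  apply/seteqP; split => x /=; rewrite in_itv /= => -[xI xN]; split => //.
    by move=> [j /= /andP[_ /eqP jk] jx]; exact: xN jk jx.
  move=> j jk jx; apply: xN; exists j => //=.
  by rewrite mem_index_enum jk eqxx.
have busy_measure : lebesgue_measure busy =
    (\sum_(j < n | machine S j == k) duration I j)%:E.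
  rewrite measure_bigsetU_ord_cond => [|j _|]; last 2 first.
  - exact: measurable_itv.
  - apply/trivIsetP => i j /= /eqP ik /eqP jk ij; apply: disj => //.
    by rewrite ik jk.
  rewrite -sumEFin; apply: eq_bigr => j _; exact: measure_occupation.
have lenE : lebesgue_measure `[0, makespan I S]%classic = (makespan I S)%:E.
  rewrite lebesgue_measure_itv /= lte_fin.
  have := makespan_ge0 I S; rewrite le_eqVlt => /predU1P[<-|->].
    by rewrite ltxx.
  by rewrite oppr0 adde0.
rewrite /idle_time idleE -busy_measure -lenE.
rewrite -measureU //; last 2 first.
- by apply: measurableD => //; exact: measurable_itv.
- by rewrite setDKI.
by rewrite setUC setDUK.
Qed.

Lemma total_idle_timeE (R : realType) (n : nat) (I : instance R n)
    (S : schedule R n) :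
  feasible I S ->
  total_idle_time I S = (makespan I S *+ 2 - workload I)%:E.
Proof.
move=> SF.
pose busy_time k : R := \sum_(j < n | machine S j == k) duration I j.
have idleE k : idle_time I S k = (makespan I S - busy_time k)%:E.
  by rewrite EFinB -(idle_time_add_busy k SF) addeK.
rewrite /total_idle_time (eq_bigr _ (fun k _ => idleE k)) sumEFin; congr EFin.
rewrite sumrB sumr_const card_ord /workload.
by rewrite [in RHS](partition_big (machine S) predT).
Qed.

Theorem mainTheorem4 (R : realType) (n : nat) (I : instance R n)
    (S : schedule R n) :
  feasible I S ->
  (minimizes (feasible I) (makespan I) S <->
   minimizes (feasible I) (total_idle_time I) S).
Proof.
move=> SF.
have idle_le S' : feasible I S' ->
    (total_idle_time I S <= total_idle_time I S')%O =
    (makespan I S <= makespan I S')%O.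
  by move=> S'F; rewrite !total_idle_timeE // lee_fin lerD2r lerMn2r.
split=> -[_ Smin]; split=> // S' S'F; have := Smin S' S'F; by rewrite idle_le.
Qed.
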